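(* Let $n\ge1$, $e\ge 0$ and $t>1$ be integers and $q=(2e+1)t$. If $C\in PL^{\infty}(n,e,q)$ and $I\subseteq[n]$, then $C\langle I\rangle$ is a perfect code in $H_I$ with packing radius $e$.
   Context: For $a\in\mathbb{Z}_q$ with representative $\tilde a\in\{0,\dots,q-1\}$ put $|a|_1=\min\{\tilde a,q-\tilde a\}$. The maximum metric on $\mathbb{Z}_q^n$ is $d(x,y)=\max_i|x_i-y_i|_1$, and $B(x,r)=\{y\in\mathbb{Z}_q^n: d(x,y)\le r\}$. $PL^{\infty}(n,e,q)$ is the set of perfect codes with packing radius $e$, i.e. of subsets $C\subseteq\mathbb{Z}_q^n$ with $\#C>1$ such that $\mathbb{Z}_q^n$ is the disjoint union of the balls $B(c,e)$, $c\in C$. Let $[n]=\{1,\dots,n\}$ and $I\subseteq[n]$. $H_I=\{x\in\mathbb{Z}_q^n: x_i=0\ \forall i\in I\}$. $\pi_I:\mathbb{Z}_q^n\to\mathbb{Z}_q^n$ is the homomorphism with $\pi_I(e_i)=0$ for $i\in I$ and $\pi_I(e_i)=e_i$ for $i\notin I$. $B(H_I,e)=\bigcup_{h\in H_I}B(h,e)$. The cartesian section of $C$ is $C\langle I\rangle=\pi_I(B(H_I,e)\cap C)$. For $S\subseteq\mathbb{Z}_q^n$, a subset $D\subseteq S$ is a perfect code in $S$ with packing radius $e$ if $S$ is the disjoint union of the sets $B(c,e)\cap S$, $c\in D$. *)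

(* Defs.v *)
From mathcomp Require Import all_boot all_order all_algebra.

Set Implicit Arguments.
Unset Strict Implicit.
Unset Printing Implicit Defensive.

Import GRing.Theory.
Local Open Scope ring_scope.

(* The space (Z/q)^n is 'rV['Z_q]_n. As 'Z_q is Z/q only for 1 < q, all the
   notions below are meant for 1 < q; the value of a : 'Z_q in nat is then its
   representative in {0, ..., q - 1}. *)

Definition lee_weight (q : nat) (a : 'Z_q) : nat := minn a (q - a).

Definition max_dist (q n : nat) (x y : 'rV['Z_q]_n) : nat :=
  (\max_(i < n) lee_weight (x 0%R i - y 0%R i)%R)%N.

Definition mball (q n : nat) (x : 'rV['Z_q]_n) (r : nat) : {set 'rV['Z_q]_n} :=
  [set y | (max_dist x y <= r)%N].

Definition disjoint_union_of (I T : finType) (S : {set T}) (D : {set I})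
    (F : I -> {set T}) : Prop :=
  S = \bigcup_(c in D) F c
  /\ {in D &, forall c c', c != c' -> [disjoint F c & F c']}.

Definition perfect_code_in (q n : nat) (S D : {set 'rV['Z_q]_n}) (e : nat)
    : Prop :=
  D \subset S /\ disjoint_union_of S D (fun c => mball c e :&: S).

(* C \in PL^oo(n, e, q) *)
Definition PLinf (n e q : nat) (C : {set 'rV['Z_q]_n}) : Prop :=
  (1 < #|C|)%N /\ disjoint_union_of [set: 'rV['Z_q]_n] C (fun c => mball c e).

Definition coord_subspace (q n : nat) (I : {set 'I_n}) : {set 'rV['Z_q]_n} :=
  [set x : 'rV['Z_q]_n | [forall i in I, x 0 i == 0]].

Definition coord_proj (q n : nat) (I : {set 'I_n}) (x : 'rV['Z_q]_n)
    : 'rV['Z_q]_n :=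
  \row_i (if i \in I then 0 else x 0 i).

(* coord_proj I is the homomorphism killing the e_i with i \in I and fixing
   the other e_i. *)
Lemma coord_projD (q n : nat) (I : {set 'I_n}) :
  {morph @coord_proj q n I : x y / x + y}.
Proof.
by move=> x y; apply/rowP=> i; rewrite !mxE; case: ifP; rewrite ?addr0.
Qed.

Lemma coord_proj_delta (q n : nat) (I : {set 'I_n}) (i : 'I_n) :
  @coord_proj q n I (delta_mx 0 i) = if i \in I then 0 else delta_mx 0 i.
Proof.
apply/rowP=> j; rewrite !mxE; have [->|ne_ji] := eqVneq j i.
  by case: ifP => _; rewrite !mxE ?eqxx.
by rewrite andbF if_same; case: ifP => _; rewrite !mxE ?(negPf ne_ji) ?andbF.
Qed.

Definition set_ball (q n : nat) (S : {set 'rV['Z_q]_n}) (r : nat)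
    : {set 'rV['Z_q]_n} :=
  \bigcup_(h in S) mball h r.

Definition cartesian_section (q n : nat) (e : nat) (C : {set 'rV['Z_q]_n})
    (I : {set 'I_n}) : {set 'rV['Z_q]_n} :=
  coord_proj I @: (set_ball (coord_subspace q I) e :&: C).

(* Main.v *)
Require Import Defs.
From mathcomp Require Import all_boot all_order all_algebra.

(** The section is governed by one observation.  A codeword [c] lies within
    distance [e] of [H_I] exactly when all its coordinates indexed by [I] have
    Lee weight at most [e].  The maximum metric is checked coordinate by
    coordinate, and a point of [H_I] is zero on [I]; hence, for such a [c], the
    balls of radius [e] around [c] and around its projection have the same trace
    on [H_I] ([mball_coord_proj]), whereas a codeword farther from [H_I] has a
    ball that misses [H_I] altogether.  So the traces on [H_I] of the balls
    around the projected codewords are exactly the nonempty traces of the balls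
    of the original partition: they cover [H_I], and two distinct projections
    come from two distinct codewords, whose balls are disjoint. *)

Import GRing.Theory.
Local Open Scope ring_scope.

Section LeeMetric.

Set Implicit Arguments.
Unset Strict Implicit.

Variables q n : nat.
Implicit Types (x y c h : 'rV['Z_q]_n) (I : {set 'I_n}).

Lemma lee_weight0 : lee_weight (0 : 'Z_q) = 0%N.
Proof. by rewrite /lee_weight /= min0n. Qed.

(** The two representatives [a] and [q - a] of the minimum swap under negation.
    This is where [1 < q] matters: otherwise [q] is not the modulus of ['Z_q]. *)
Lemma lee_weightN (a : 'Z_q) : (1 < q)%N -> lee_weight (- a) = lee_weight a.
Proof.
move=> q_gt1; rewrite /lee_weight.
have lt_aq : (a < q)%N by rewrite -[X in (_ < X)%N](Zp_cast q_gt1) ltn_ord.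
have -> : nat_of_ord (- a) = ((q - a) %% q)%N.
  by congr ((_ - _) %% _)%N; apply: Zp_cast.
have [-> | a_gt0] := posnP a; first by rewrite subn0 modnn !min0n.
by rewrite modn_small ?ltn_subrL ?a_gt0 ?(ltnW q_gt1) // subKn 1?minnC // ltnW.
Qed.

Lemma max_dist_leP x y (r : nat) :
  reflect (forall i, (lee_weight (x 0 i - y 0 i)%R <= r)%N) (max_dist x y <= r)%N.
Proof.
by apply: (iffP (bigmax_leqP _ _ _)) => le_r i *; apply: le_r.
Qed.

Lemma max_distC x y : (1 < q)%N -> max_dist x y = max_dist y x.
Proof.
by move=> q_gt1; apply: eq_bigr => i _; rewrite -lee_weightN // opprB.
Qed.

Lemma coord_subspaceP I x :
  reflect {in I, forall i, x 0 i = 0} (x \in coord_subspace q I).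
Proof.
rewrite inE; apply: (iffP forall_inP) => x0 i iI; first exact/eqP/x0.
exact/eqP/x0.
Qed.

Lemma coord_proj_in_subspace I x : coord_proj I x \in coord_subspace q I.
Proof. by apply/coord_subspaceP => i iI; rewrite mxE iI. Qed.

Lemma mem_set_ball (S : {set 'rV['Z_q]_n}) x h (r : nat) :
  (1 < q)%N -> h \in S -> h \in mball x r -> x \in set_ball S r.
Proof.
move=> q_gt1 hS; rewrite inE => le_r.
by apply/bigcupP; exists h => //; rewrite inE max_distC.
Qed.

(** Near [H_I] the coordinates in [I] impose no condition on either side: they
    contribute weight at most [r] to the distance to [c], and weight [0] to the
    distance to its projection. *)
Lemma mball_coord_proj I c h (r : nat) :
  (1 < q)%N -> c \in set_ball (coord_subspace q I) r ->
  h \in coord_subspace q I -> (h \in mball (coord_proj I c) r) = (h \in mball c r).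
Proof.
move=> q_gt1 /bigcupP[k /coord_subspaceP k0 + ] /coord_subspaceP h0.
rewrite !inE max_distC // => /max_dist_leP le_ck.
apply/max_dist_leP/max_dist_leP => le_r i; have := le_r i; rewrite mxE.
  by case: ifP => // iI _; have := le_ck i; rewrite k0 // h0.
by case: ifP => // iI _; rewrite h0 // subr0 lee_weight0.
Qed.

End LeeMetric.

(** A point of [H_I] lies in the ball of some codeword, which is then close to
    [H_I] and therefore survives in the section; for disjointness, a common point
    of two projected traces would lie in the balls of both codewords. *)
Lemma cartesian_section_perfect (n e q : nat) (C : {set 'rV['Z_q]_n})
    (I : {set 'I_n}) :
  (1 < q)%N -> disjoint_union_of [set: 'rV['Z_q]_n] C (fun c => mball c e) ->
  perfect_code_in (coord_subspace q I) (cartesian_section e C I) e.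
Proof.
move=> q_gt1 [cover_C disj_C]; split.
  by apply/subsetP => _ /imsetP[c _ ->]; apply: coord_proj_in_subspace.
split.
  apply/setP => h; apply/idP/bigcupP => [hI | [_ _ /setIP[]//]].
  have : h \in [set: 'rV['Z_q]_n] by rewrite inE.
  rewrite cover_C => /bigcupP[c cC hc].
  have c_near := mem_set_ball q_gt1 hI hc.
  exists (coord_proj I c); first by rewrite imset_f // inE c_near.
  by rewrite inE mball_coord_proj ?hc.
move=> _ _ /imsetP[c /setIP[c_near cC] ->] /imsetP[c' /setIP[c'_near c'C] ->].
move=> ne_cc'; rewrite -setI_eq0; apply/eqP/setP => h; rewrite in_set0.
apply/negP => /setIP[/setIP[hc hI] /setIP[hc' _]].
rewrite mball_coord_proj // in hc; rewrite mball_coord_proj // in hc'.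
have ne : c != c' by apply: contraNneq ne_cc' => ->.
by have /disjointFr/(_ hc) := disj_C c c' cC c'C ne; rewrite hc'.
Qed.

Theorem proposition4p23 (n e t q : nat) (hn : (1 <= n)%N) (ht : (1 < t)%N)
    (hq : q = ((2 * e + 1) * t)%N) (C : {set 'rV['Z_q]_n}) (I : {set 'I_n}) :
  PLinf e C -> perfect_code_in (coord_subspace q I) (cartesian_section e C I) e.
Proof.
case=> _; apply: cartesian_section_perfect.
by rewrite hq (leq_trans ht) // leq_pmull // addn1.
Qed.
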